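(* Let $I$ be a countable index set and $(M_i)_{i\in I}$ countable $L$-structures, and let $M=\prod_{i\in I}M_i$, viewed as a two-sorted structure in the Feferman–Vaught language: one sort is the product $\prod_i M_i$, the other is the Boolean algebra $\mathcal P(I)$ with its Boolean operations, and for each $L$-formula $\phi(x_1,\dots,x_n)$ there is a function $[\phi]:(\prod_i M_i)^n\to\mathcal P(I)$ with $[\phi](a_1,\dots,a_n)=\{i\in I: M_i\models\phi(a_1(i),\dots,a_n(i))\}$. Equip $\prod_i M_i$ with the product topology of the discrete spaces $M_i$ (a Polish space). Then every equivalence relation on $(\prod_i M_i)^n$ that is definable without parameters in this structure is smooth.
   Context: An equivalence relation $E$ on a standard Borel space $Z$ is smooth if there is a Borel map $\theta$ from $Z$ into a Polish space with $x\,E\,y\iff\theta(x)=\theta(y)$. *)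

(* Defs.v *)
From Stdlib Require Import Reals List RelationClasses.
From Stdlib Require Fin.
Set Implicit Arguments.
Unset Strict Implicit.

Record language := {
  Fsym : Type;
  farity : Fsym -> nat;
  Rsym : Type;
  rarity : Rsym -> nat }.

Inductive term (L : language) : Type :=
| tvar : nat -> term L
| tapp : forall f : Fsym L, (Fin.t (farity f) -> term L) -> term L.

Inductive formula (L : language) : Type :=
| ffalse : formula L
| feq : term L -> term L -> formula L
| frel : forall r : Rsym L, (Fin.t (rarity r) -> term L) -> formula L
| fnot : formula L -> formula L
| fand : formula L -> formula L -> formula L
| for_ : formula L -> formula L -> formula L
| fimp : formula L -> formula L -> formula L
| fex : nat -> formula L -> formula L
| fall : nat -> formula L -> formula L.

Record structure (L : language) := {
  carrier :> Type;
  finterp : forall f : Fsym L, (Fin.t (farity f) -> carrier) -> carrier;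
  rinterp : forall r : Rsym L, (Fin.t (rarity r) -> carrier) -> Prop }.

Definition upd (A : Type) (e : nat -> A) (k : nat) (a : A) : nat -> A :=
  fun j => if Nat.eqb j k then a else e j.

Fixpoint teval (L : language) (M : structure L) (env : nat -> M) (t : term L)
  : carrier M :=
  match t with
  | tvar _ k => env k
  | @tapp _ f ts => @finterp _ M f (fun j => teval env (ts j))
  end.

Fixpoint sat (L : language) (M : structure L) (env : nat -> M) (phi : formula L)
  : Prop :=
  match phi with
  | ffalse _ => False
  | feq t1 t2 => teval env t1 = teval env t2
  | @frel _ r ts => @rinterp _ M r (fun j => teval env (ts j))
  | fnot p => ~ sat env p
  | fand p q => sat env p /\ sat env q
  | for_ p q => sat env p \/ sat env q
  | fimp p q => sat env p -> sat env q
  | fex k p => exists a : carrier M, sat (upd env k a) p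
  | fall k p => forall a : carrier M, sat (upd env k a) p
  end.

Definition countable_type (T : Type) : Prop :=
  exists f : T -> nat, forall x y, f x = f y -> x = y.

(* Terms of the Boolean-algebra sort P(I).  [bbr phi s] is [phi] applied to
   product-sort variables: the L-variable k is fed the product variable s k. *)
Inductive bterm (L : language) : Type :=
| bvar : nat -> bterm L
| bzero : bterm L
| bone : bterm L
| bunion : bterm L -> bterm L -> bterm L
| binter : bterm L -> bterm L -> bterm L
| bcompl : bterm L -> bterm L
| bbr : formula L -> (nat -> nat) -> bterm L.

Inductive fvformula (L : language) : Type :=
| fvfalse : fvformula L
| fvbeq : bterm L -> bterm L -> fvformula L
| fvpeq : nat -> nat -> fvformula L
| fvnot : fvformula L -> fvformula L
| fvand : fvformula L -> fvformula L -> fvformula L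
| fvor : fvformula L -> fvformula L -> fvformula L
| fvimp : fvformula L -> fvformula L -> fvformula L
| fvexP : nat -> fvformula L -> fvformula L
| fvallP : nat -> fvformula L -> fvformula L
| fvexB : nat -> fvformula L -> fvformula L
| fvallB : nat -> fvformula L -> fvformula L.

Definition prodM (L : language) (I : Type) (M : I -> structure L) : Type :=
  forall i : I, carrier (M i).

Fixpoint bteval (L : language) (I : Type) (M : I -> structure L)
  (pe : nat -> prodM M) (be : nat -> I -> Prop) (a : bterm L) : I -> Prop :=
  match a with
  | bvar _ k => be k
  | bzero _ => fun _ => False
  | bone _ => fun _ => True
  | bunion a1 a2 => fun i => bteval pe be a1 i \/ bteval pe be a2 i
  | binter a1 a2 => fun i => bteval pe be a1 i /\ bteval pe be a2 i
  | bcompl a1 => fun i => ~ bteval pe be a1 i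
  | bbr phi s => fun i => @sat _ (M i) (fun k => pe (s k) i) phi
  end.

Fixpoint fvsat (L : language) (I : Type) (M : I -> structure L)
  (pe : nat -> prodM M) (be : nat -> I -> Prop) (psi : fvformula L) : Prop :=
  match psi with
  | fvfalse _ => False
  | fvbeq a1 a2 => forall i, bteval pe be a1 i <-> bteval pe be a2 i
  | fvpeq _ k l => forall i, pe k i = pe l i
  | fvnot p => ~ fvsat pe be p
  | fvand p q => fvsat pe be p /\ fvsat pe be q
  | fvor p q => fvsat pe be p \/ fvsat pe be q
  | fvimp p q => fvsat pe be p -> fvsat pe be q
  | fvexP k p => exists a : prodM M, fvsat (upd pe k a) be p
  | fvallP k p => forall a : prodM M, fvsat (upd pe k a) be p
  | fvexB k p => exists A : I -> Prop, fvsat pe (upd be k A) p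
  | fvallB k p => forall A : I -> Prop, fvsat pe (upd be k A) p
  end.

Definition fin_nat (n : nat) (k : Fin.t n) : nat := proj1_sig (Fin.to_nat k).

(* E on (prod M)^n x (prod M)^n is defined without parameters by psi:
   x occupies product variables 0..n-1 and y product variables n..2n-1
   (the truth value of psi being required not to depend on anything else). *)
Definition fv_definable_rel (L : language) (I : Type) (M : I -> structure L)
  (n : nat) (E : (Fin.t n -> prodM M) -> (Fin.t n -> prodM M) -> Prop) : Prop :=
  exists psi : fvformula L,
    forall (pe : nat -> prodM M) (be : nat -> I -> Prop)
           (x y : Fin.t n -> prodM M),
      (forall k : Fin.t n, pe (fin_nat k) = x k /\ pe (n + fin_nat k)%nat = y k) ->
      (E x y <-> fvsat pe be psi).

Inductive sigma_gen (X : Type) (G : (X -> Prop) -> Prop) : (X -> Prop) -> Prop :=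
| sg_base : forall A, G A -> sigma_gen G A
| sg_compl : forall A, sigma_gen G A -> sigma_gen G (fun x => ~ A x)
| sg_union : forall A : nat -> X -> Prop,
    (forall k, sigma_gen G (A k)) -> sigma_gen G (fun x => exists k, A k x)
| sg_ext : forall A B, sigma_gen G A -> (forall x, A x <-> B x) -> sigma_gen G B.

Definition prod_open (L : language) (I : Type) (M : I -> structure L) (n : nat)
  (U : (Fin.t n -> prodM M) -> Prop) : Prop :=
  forall x, U x -> exists F : list (Fin.t n * I),
    forall y, (forall p, In p F -> y (fst p) (snd p) = x (fst p) (snd p)) -> U y.

Definition prod_borel (L : language) (I : Type) (M : I -> structure L) (n : nat) :=
  sigma_gen (@prod_open L I M n).

Record is_metric (Y : Type) (d : Y -> Y -> R) : Prop := {
  d_nonneg : forall x y, (0 <= d x y)%R;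
  d_zero : forall x y, d x y = 0%R <-> x = y;
  d_sym : forall x y, d x y = d y x;
  d_tri : forall x y z, (d x z <= d x y + d y z)%R }.

Definition cauchy_seq (Y : Type) (d : Y -> Y -> R) (u : nat -> Y) : Prop :=
  forall eps, (0 < eps)%R -> exists N, forall m k, (N <= m)%nat -> (N <= k)%nat ->
    (d (u m) (u k) < eps)%R.

Definition converges_to (Y : Type) (d : Y -> Y -> R) (u : nat -> Y) (y : Y) : Prop :=
  forall eps, (0 < eps)%R -> exists N, forall m, (N <= m)%nat -> (d (u m) y < eps)%R.

Definition complete_metric (Y : Type) (d : Y -> Y -> R) : Prop :=
  forall u, cauchy_seq d u -> exists y, converges_to d u y.

Definition separable_metric (Y : Type) (d : Y -> Y -> R) : Prop :=
  exists S : Y -> Prop,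
    (exists f : Y -> nat, forall x y, S x -> S y -> f x = f y -> x = y) /\
    (forall y eps, (0 < eps)%R -> exists s, S s /\ (d y s < eps)%R).

Definition polish_metric (Y : Type) (d : Y -> Y -> R) : Prop :=
  is_metric d /\ complete_metric d /\ separable_metric d.

Definition metric_open (Y : Type) (d : Y -> Y -> R) (U : Y -> Prop) : Prop :=
  forall y, U y -> exists eps, (0 < eps)%R /\ forall z, (d y z < eps)%R -> U z.

Definition smooth (X : Type) (borelX : (X -> Prop) -> Prop) (E : X -> X -> Prop)
  : Prop :=
  exists (Y : Type) (d : Y -> Y -> R), polish_metric d /\
    exists theta : X -> Y,
      (forall B, sigma_gen (metric_open d) B -> borelX (fun x => B (theta x))) /\
      (forall x y, E x y <-> theta x = theta y).

(* Main.v *)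
Require Import Defs.
From Stdlib Require Import Reals List RelationClasses.
From Stdlib Require Fin FinFun.
From Stdlib Require Import Lra.
From mathcomp Require Import all_boot.
From mathcomp Require Import boolp.
From mathcomp Require Import zify.

Set Implicit Arguments.
Unset Strict Implicit.
Unset Printing Implicit Defensive.

(** Feferman-Vaught, semantically: colour each index [i] by finitely many colours
    according to the [i]-th coordinates of the variables. The truth value of a formula
    is determined by the numbers, truncated at some [N], of indices of each colour;
    for a quantifier, colour [i] by the set of colours that become attainable at [i].
    "At least [m] indices have colour [k]" is an open condition, so [E], its classes
    and the [E]-saturations of basic cylinders are finite Boolean combinations of open
    sets. The saturations form a countable Borel family; it separates the classes,
    because two classes with the same closure meet. *)

(** * Cardinalities truncated at a finite bound, and transport of splittings and colourings *)

Section TruncatedCardinality.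
Variable I : eqType.
Implicit Types (A B : I -> Prop) (m N : nat).

Definition atleast m A :=
  exists2 l : seq I, uniq l /\ size l = m & forall i, i \in l -> A i.

(** Equivalently, min(|A|, N) = min(|A'|, N), infinite sets included. *)
Definition same N A A' := forall m, m <= N -> atleast m A <-> atleast m A'.

Lemma atleast_sub m m' A A' :
  m' <= m -> (forall i, A i -> A' i) -> atleast m A -> atleast m' A'.
Proof.
move=> le_m sAA' [l [Ul sl] lA]; exists (take m' l).
  by rewrite take_uniq // size_takel // sl.
by move=> i /mem_take/lA/sAA'.
Qed.

Lemma atleast0 A : atleast 0 A.
Proof. by exists [::]. Qed.

Lemma atleast1P A : atleast 1 A <-> exists i, A i.
Proof.
split=> [[[|i l] [//]] _ _ lA|[i Ai]]; first by exists i; apply/lA/mem_head.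
by exists [:: i] => // j; rewrite inE => /eqP->.
Qed.

Lemma atleast_add m1 m2 A B :
  atleast m1 (fun i => A i /\ B i) -> atleast m2 (fun i => A i /\ ~ B i) ->
  atleast (m1 + m2) A.
Proof.
move=> [l1 [U1 s1] lA1] [l2 [U2 s2] lA2]; exists (l1 ++ l2).
  rewrite cat_uniq U1 U2 size_cat s1 s2 andbT; split=> //.
  by apply/hasPn => i /lA2[_ nB]; apply/negP => /lA1[].
by move=> i; rewrite mem_cat => /orP[/lA1[]|/lA2[]].
Qed.

Lemma atleast_split m A B : atleast m A ->
  exists m1 m2, [/\ m = m1 + m2, atleast m1 (fun i => A i /\ B i)
                  & atleast m2 (fun i => A i /\ ~ B i)].
Proof.
move=> [l [Ul sl] lA].
exists (count (fun i => `[< B i >]) l), (count (fun i => ~~ `[< B i >]) l).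
split; first by rewrite -sl -(count_predC (fun i => `[< B i >]) l).
- exists (filter (fun i => `[< B i >]) l); first by rewrite filter_uniq // size_filter.
  by move=> i; rewrite mem_filter => /andP[/asboolP Bi /lA].
- exists (filter (fun i => ~~ `[< B i >]) l); first by rewrite filter_uniq // size_filter.
  by move=> i; rewrite mem_filter => /andP[/asboolPn Bi /lA].
Qed.

Lemma atleast_exact p A : atleast p A ->
  exists2 B : I -> Prop, (forall i, B i -> A i) & forall m, atleast m B <-> m <= p.
Proof.
move=> [l [Ul sl] lA]; exists (fun i => i \in l) => // m; split.
  by move=> [l' [U' <-] sl']; rewrite -sl; apply: uniq_leq_size.
by move=> le_mp; apply: (@atleast_sub p m (fun i => i \in l)) => //; exists l.
Qed.

Lemma exact_of_not_atleast N A : ~ atleast N A ->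
  exists2 p, p < N & forall m, atleast m A <-> m <= p.
Proof.
elim: N => [|N IH] nA; first by case: nA; apply: atleast0.
case: (pselect (atleast N A)) => [yA|/IH[p ltp pP]]; last first.
  by exists p => //; apply: ltnW.
exists N => // m; split=> [mA|le_mN]; last exact: atleast_sub yA.
by rewrite leqNgt; apply/negP => lt_Nm; apply: nA; apply: atleast_sub mA.
Qed.

Lemma atleast_diff p m A B :
  (forall m, atleast m (fun i => A i /\ B i) <-> m <= p) ->
  atleast m (fun i => A i /\ ~ B i) <-> atleast (p + m) A.
Proof.
move=> pP; split=> [|/(@atleast_split _ _ B)[m1 [m2 [e /pP le1 mA]]]].
  by apply: atleast_add; apply/pP.
by apply: atleast_sub mA => //; lia.
Qed.

Lemma same_sym N A A' : same N A A' -> same N A' A.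
Proof. by move=> sA m /sA; tauto. Qed.

Lemma same_ext N A A' B B' : (forall i, A i <-> B i) -> (forall i, A' i <-> B' i) ->
  same N A A' -> same N B B'.
Proof.
move=> AB AB' sA m /sA[h1 h2].
by split=> mB; [apply: (@atleast_sub m m A') => [//|i /AB'//|]; apply: h1
  |apply: (@atleast_sub m m A) => [//|i /AB//|]; apply: h2];
  apply: atleast_sub mB => // i; [move/AB|move/AB'].
Qed.

Lemma same_exists N A A' : 0 < N -> same N A A' -> (exists i, A' i) -> exists i, A i.
Proof. by move=> N0 /(_ 1 N0) sA /atleast1P/sA/atleast1P. Qed.

(** If [A] meets [B] in exactly p < N points, any p points of [A'] serve as [B']. Removing p points
    shifts counts by p, and p + m stays within the bound N + K for m <= K. *)
Lemma same_split_small N K A A' B : same (N + K) A A' ->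
  ~ atleast N (fun i => A i /\ B i) ->
  exists B' : I -> Prop, same N (fun i => A i /\ B i) (fun i => A' i /\ B' i) /\
    same K (fun i => A i /\ ~ B i) (fun i => A' i /\ ~ B' i).
Proof.
move=> sA /exact_of_not_atleast[p ltpN pP].
have /atleast_exact[B' sB' pP'] : atleast p A'.
  by apply/sA; [lia|apply: (@atleast_sub p p (fun i => A i /\ B i))
    => // [i []//|]; apply/pP].
have pP'' m : atleast m (fun i => A' i /\ B' i) <-> m <= p.
  by rewrite -pP'; split; apply: atleast_sub => // i; [case|move=> Bi; split; auto].
exists B'; split=> m le_m; first by rewrite pP pP''.
by rewrite (atleast_diff _ pP) (atleast_diff _ pP''); apply: sA; lia.
Qed.

Lemma same_split N K A A' B : same (N + K) A A' ->
  exists B' : I -> Prop, same N (fun i => A i /\ B i) (fun i => A' i /\ B' i) /\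
    same K (fun i => A i /\ ~ B i) (fun i => A' i /\ ~ B' i).
Proof.
move=> sA.
case: (pselect (atleast N (fun i => A i /\ B i))) => [aN|]; last first.
  exact: same_split_small.
case: (pselect (atleast K (fun i => A i /\ ~ B i))) => [aK|aK]; last first.
  (* The remainder is the small piece here: exchange the roles of the two pieces and complement the
     set obtained. *)
  rewrite addnC in sA; have [B' [s1 s2]] := same_split_small sA aK.
  exists (fun i => ~ B' i).
  by split; [apply: same_ext s2|apply: same_ext s1] => i; rewrite ?not_notE.
(* Both pieces reach their bounds, so exactly N points of [A'] can be taken, leaving at least K
   others. *)
have aA' : atleast (N + K) A' by apply/(sA _ (leqnn _)); exact: atleast_add aN aK.
have /atleast_exact[B' sB' pP'] : atleast N A' by apply: atleast_sub aA' => //; lia.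
have pP'' m : atleast m (fun i => A' i /\ B' i) <-> m <= N.
  by rewrite -pP'; split; apply: atleast_sub => // i; [case|move=> Bi; split; auto].
exists B'; split=> m le_m; split=> _.
- exact/pP''.
- exact: atleast_sub aN.
- by apply/(atleast_diff _ pP''); apply: atleast_sub aA' => //; lia.
- exact: atleast_sub aK.
Qed.

(** Colours are split off one at a time, each using up N of the bound. The final 1 ensures that once
    the colours run out and [A] is empty, [A'] is empty too. *)
Lemma same_colour (K : eqType) (ks : seq K) N A A' (f : I -> K) : 0 < N ->
  (forall i, A i -> f i \in ks) -> same (N * size ks + 1) A A' ->
  exists f' : I -> K,
    forall k, same N (fun i => A i /\ f i = k) (fun i => A' i /\ f' i = k).
Proof.
move=> N0; elim: ks A A' => [|k ks IH] A A' fA sA.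
  have nA i : ~ A i by move/fA.
  have nA' i : ~ A' i.
    rewrite addn1 in sA; move=> A'i.
    by have [j /nA] := same_exists (ltn0Sn _) sA (ex_intro _ i A'i).
  by exists f => k m le_m; split; apply: atleast_sub => // i [] Ai; case: (nA i Ai) || case: (nA' i Ai).
have {}sA : same (N + (N * size ks + 1)) A A' by rewrite addnA -mulnS.
have [B' [s1 s2]] := same_split (fun i => f i = k) sA.
have [|f' f'P] := IH _ _ _ s2.
  by move=> i [/fA + fk]; rewrite inE => /orP[/eqP|].
exists (fun i => if `[< B' i >] then k else f' i) => k0.
have [->|nk] := eqVneq k0 k.
  apply: same_ext s1 => // i; case: asboolP => Bi; first by tauto.
  (* Outside [B'] the map [f'] never takes the value [k]: since N > 0, such an index would yield one
     in [A] with both [f j <> k] and [f j = k]. *)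
  split=> [[]//|[A'i fk]]; exfalso.
  have [] := same_exists N0 (f'P k) (ex_intro _ i (conj (conj A'i Bi) fk)).
  by move=> j [[_]].
apply: same_ext (f'P k0) => i.
  by split=> [[[]]//|[Ai fi]]; do 2?split=> //; apply/eqP; rewrite fi.
case: asboolP => Bi; last by tauto.
by split=> [[[]]//|[_ kk]]; rewrite kk eqxx in nk.
Qed.

(** A lower bound m <= N on the whole is a sum of lower bounds on the finitely many colour classes,
    each at most N, so each transfers separately. *)
Lemma same_refine (T : finType) N A A' (col col' : I -> T) :
  (forall t, same N (fun i => A i /\ col i = t) (fun i => A' i /\ col' i = t)) ->
  same N A A'.
Proof.
have oneway (ts : seq T) (g g' : I -> T) : forall B B' m, m <= N ->
    (forall i, B i -> g i \in ts) ->
    (forall t, same N (fun i => B i /\ g i = t) (fun i => B' i /\ g' i = t)) ->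
    atleast m B -> atleast m B'.
  elim: ts => [|t ts IH] B B' m le_m gts sB.
    by case=> [[|i l]] [_ <-] lB; [apply: atleast0|have /lB/gts := mem_head i l].
  move=> /(@atleast_split _ _ (fun i => g i = t))[m1 [m2 [e b1 b2]]].
  rewrite e; apply: (@atleast_add _ _ _ (fun i => g' i = t)); first by apply/sB => //; lia.
  apply: IH b2; first by lia.
    by move=> i [/gts + gt]; rewrite inE => /orP[/eqP|].
  move=> u; have [->|nu] := eqVneq u t.
    by move=> m' _; split; apply: atleast_sub => // i []; tauto.
  apply: same_ext (sB u) => i; split=> [[Bi gu]|[[]//]];
    by do 2?split=> //; rewrite gu; apply/eqP.
move=> sA m le_m; split; apply: (oneway (enum T)) => //; try by move=> i; rewrite mem_enum.
by move=> t; apply: same_sym.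
Qed.

End TruncatedCardinality.

(** * Predicates determined by truncated colour counts, and their closure properties *)

Section Tame.
Variable I : eqType.

Definition census_eq (S : I -> Type) (K : finType) (c : forall i, S i -> K) (N : nat)
    (s s' : forall i, S i) :=
  forall k, same N (fun i => c i (s i) = k) (fun i => c i (s' i) = k).

(** The colouring may vary with the index, so it can absorb parameters such as a fixed point of the
    product. Positivity of [N] lets the counts detect whether a colour occurs at all. *)
Definition tame (S : I -> Type) (P : (forall i, S i) -> Prop) :=
  exists (K : finType) (c : forall i, S i -> K) (N : nat), 0 < N /\
    forall s s', census_eq c N s s' -> P s -> P s'.

Section Closure.
Variable S : I -> Type.
Implicit Types P Q : (forall i, S i) -> Prop.

Lemma tame_ext P Q : (forall s, P s <-> Q s) -> tame P -> tame Q.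
Proof.
move=> PQ [K [c [N [N0 cP]]]]; exists K, c, N; split=> // s s' ss' /PQ Ps.
exact/PQ/(cP s).
Qed.

Lemma tame_pullback (S' : I -> Type) (h : forall i, S' i -> S i) P :
  tame P -> tame (fun s => P (fun i => h i (s i))).
Proof.
move=> [K [c [N [N0 cP]]]]; exists K, (fun i u => c i (h i u)), N; split=> // s s' ss'.
exact: cP.
Qed.

Lemma tame_false : tame (fun _ : forall i, S i => False).
Proof. by exists unit, (fun _ _ => tt), 1. Qed.

Lemma tame_all (p : forall i, S i -> Prop) : tame (fun s => forall i, p i (s i)).
Proof.
exists bool, (fun i u => `[< p i u >]), 1; split=> // s s' /(_ false) ss' ps i.
apply: contrapT => /asboolPn/negbTE npi.
have [] := same_exists (ltn0Sn _) ss' (ex_intro _ i npi).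
by move=> j /negbT/asboolPn; apply.
Qed.

Lemma tame_not P : tame P -> tame (fun s => ~ P s).
Proof.
move=> [K [c [N [N0 cP]]]]; exists K, c, N; split=> // s s' ss' nP Ps'; apply: nP.
by apply: cP Ps' => k; apply: same_sym.
Qed.

(** The pair of colours refines both colourings; [same_refine] recovers the counts of each from
    those of the pair. *)
Lemma tame_and P Q : tame P -> tame Q -> tame (fun s => P s /\ Q s).
Proof.
move=> [K1 [c1 [N1 [N10 cP]]]] [K2 [c2 [N2 [N20 cQ]]]].
exists (K1 * K2)%type, (fun i u => (c1 i u, c2 i u)), (maxn N1 N2).
split; first by rewrite leq_max N10.
move=> s s' ss' [Ps Qs]; split.
- apply: cP Ps => k; apply: (same_refine (col := fun i => c2 i (s i))
    (col' := fun i => c2 i (s' i))) => t m le_m.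
  have {}ss' := same_ext _ _ (ss' (k, t)).
  by apply: ss' => [i|i|]; [split=> [[-> ->]|[-> ->]]..|rewrite leq_max le_m].
- apply: cQ Qs => k; apply: (same_refine (col := fun i => c1 i (s i))
    (col' := fun i => c1 i (s' i))) => t m le_m.
  have {}ss' := same_ext _ _ (ss' (t, k)).
  by apply: ss' => [i|i|]; [split=> [[-> ->]|[-> ->]]..|rewrite leq_max le_m orbT].
Qed.

Lemma tame_or P Q : tame P -> tame Q -> tame (fun s => P s \/ Q s).
Proof.
move=> /tame_not tP /tame_not tQ; apply: tame_ext (tame_not (tame_and tP tQ)) => s.
by rewrite not_andE !not_notE.
Qed.

Lemma tame_imp P Q : tame P -> tame Q -> tame (fun s => P s -> Q s).
Proof.
move=> tP /tame_not tQ; apply: tame_ext (tame_not (tame_and tP tQ)) => s.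
by split=> [nPQ Ps|PQ [/PQ]//]; apply: contrapT => nQ; apply: nPQ.
Qed.

(* The colour of [u] at [i] is the set of colours of the states reachable from [u]. *)
Lemma tame_ex (R : forall i, S i -> S i -> Prop) P :
  tame P -> tame (fun s => exists2 v, (forall i, R i (s i) (v i)) & P v).
Proof.
move=> [K [c [N [N0 cP]]]].
pose d i u := [set k | `[< exists2 v, R i u v & c i v = k >]].
exists {set K}, d, (N * size (enum K) + 1); split; first by rewrite addn1.
move=> s s' ss' [v Rsv Pv].
(* The colouring of [v] is transported separately over each set [t] of attainable colours. *)
have /choice[F FP] (t : {set K}) := @same_colour I K (enum K) N (fun i => d i (s i) = t)
  (fun i => d i (s' i) = t) (fun i => c i (v i)) N0 (fun i _ => mem_enum K _) (ss' t).
(* The colour assigned at [i] also occurs at some [j] with the same set of attainable colours, hence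
   it is attainable from [s' i]. *)
have lift i : exists w, R i (s' i) w /\ c i w = F (d i (s' i)) i.
  have [j [dj cj]] := same_exists N0 (FP (d i (s' i)) (F (d i (s' i)) i))
    (ex_intro _ i (conj erefl erefl)).
  have : c j (v j) \in d j (s j) by rewrite inE; apply/asboolP; exists (v j).
  by rewrite dj cj inE => /asboolP[w Rw cw]; exists w.
pose w i := sval (cid (lift i)).
have wP i : R i (s' i) (w i) /\ c i (w i) = F (d i (s' i)) i := svalP (cid (lift i)).
exists w => [i|]; first by case: (wP i).
apply: cP Pv => k.
apply: (same_refine (col := fun i => d i (s i)) (col' := fun i => d i (s' i))) => t.
apply: same_ext (FP t k) => i; first by tauto.
by have [_ ->] := wP i; split=> [[-> ->]|[<- ->]].
Qed.

Lemma tame_forall (R : forall i, S i -> S i -> Prop) P :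
  tame P -> tame (fun s => forall v, (forall i, R i (s i) (v i)) -> P v).
Proof.
move=> /tame_not/(tame_ex R)/tame_not; apply: tame_ext => s; split=> [nP v Rv|PR [v /PR//]].
by apply: contrapT => nPv; apply: nP; exists v.
Qed.

End Closure.
End Tame.

(** * The Feferman-Vaught theorem in semantic form: satisfaction is tame *)

Section FefermanVaught.
Variables (L : language) (I : eqType) (M : I -> structure L).

(** The coordinates at [i] of all variables of both sorts; a subset of [I] contributes the truth
    value of membership of [i]. *)
Definition fv_state (i : I) : Type := ((nat -> M i) * (nat -> Prop))%type.
Definition state_pe (s : forall i, fv_state i) : nat -> prodM M := fun k i => (s i).1 k.
Definition state_be (s : forall i, fv_state i) : nat -> I -> Prop := fun k i => (s i).2 k.

(** Overwriting one variable is expressed index by index, which is the form of quantification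
    handled by [tame_ex] and [tame_forall]. *)
Definition moveP k i (u v : fv_state i) := exists a, v = (upd u.1 k a, u.2).
Definition moveB k i (u v : fv_state i) := exists a, v = (u.1, upd u.2 k a).

(** By choice, the values picked at the separate indices assemble into a single element of the
    product. *)
Lemma movePP k (s v : forall i, fv_state i) : (forall i, moveP k (s i) (v i)) <->
  exists a, v = fun i => (upd (s i).1 k (a i), (s i).2).
Proof.
split=> [h|[a ->] i]; last by exists (a i).
exists (fun i => sval (cid (h i))); apply/functional_extensionality_dep => i.
by case: (cid (h i)).
Qed.

Lemma moveBP k (s v : forall i, fv_state i) : (forall i, moveB k (s i) (v i)) <->
  exists a, v = fun i => ((s i).1, upd (s i).2 k (a i)).
Proof.
split=> [h|[a ->] i]; last by exists (a i).
exists (fun i => sval (cid (h i))); apply/functional_extensionality_dep => i.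
by case: (cid (h i)).
Qed.

Lemma state_pe_upd k (s : forall i, fv_state i) (a : prodM M) :
  state_pe (fun i => (upd (s i).1 k (a i), (s i).2)) = upd (state_pe s) k a.
Proof.
apply/funext => j; apply/functional_extensionality_dep => i.
by rewrite /state_pe /upd /=; case: Nat.eqb.
Qed.

Lemma state_be_upd k (s : forall i, fv_state i) (a : I -> Prop) :
  state_be (fun i => ((s i).1, upd (s i).2 k (a i))) = upd (state_be s) k a.
Proof.
apply/funext => j; apply/funext => i.
by rewrite /state_be /upd /=; case: Nat.eqb.
Qed.

Fixpoint local_bteval (i : I) (u : fv_state i) (a : bterm L) : Prop :=
  match a with
  | bvar k => u.2 k
  | bzero => False
  | bone => True
  | bunion a1 a2 => local_bteval u a1 \/ local_bteval u a2
  | binter a1 a2 => local_bteval u a1 /\ local_bteval u a2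
  | bcompl a1 => ~ local_bteval u a1
  | bbr phi s => @sat _ (M i) (fun k => u.1 (s k)) phi
  end.

Lemma bteval_local (s : forall i, fv_state i) a i :
  bteval (state_pe s) (state_be s) a i = local_bteval (s i) a.
Proof. by elim: a => //= [a1 -> a2 ->|a1 -> a2 ->|a ->]. Qed.

(** Atomic formulas say that a local condition holds at every index; connectives and quantifiers
    follow from the closure properties. *)
Lemma tame_fvsat psi : tame (fun s : forall i, fv_state i => fvsat (state_pe s) (state_be s) psi).
Proof.
elim: psi => [|a b|k l|p IHp|p IHp q IHq|p IHp q IHq|p IHp q IHq|k p IHp|k p IHp
  |k p IHp|k p IHp] /=.
- exact: tame_false.
- apply: tame_ext (tame_all (fun i u => local_bteval u a <-> local_bteval u b)) => s.
  by split=> h i; move: (h i); rewrite !bteval_local.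
- exact: (tame_all (fun i (u : fv_state i) => u.1 k = u.1 l)).
- exact: tame_not.
- exact: tame_and.
- exact: tame_or.
- exact: tame_imp.
- apply: tame_ext (tame_ex (moveP k) IHp) => s; split=> [[v /movePP[a ->]]|[a h]].
    by rewrite state_pe_upd; exists a.
  exists (fun i => (upd (s i).1 k (a i), (s i).2)); first by apply/movePP; exists a.
  by rewrite state_pe_upd.
- apply: tame_ext (tame_forall (moveP k) IHp) => s; split=> [h a|h v /movePP[a ->]].
    by rewrite -state_pe_upd; apply: h; apply/movePP; exists a.
  by rewrite state_pe_upd; exact: (h a).
- apply: tame_ext (tame_ex (moveB k) IHp) => s; split=> [[v /moveBP[a ->]]|[a h]].
    by rewrite state_be_upd; exists a.
  exists (fun i => ((s i).1, upd (s i).2 k (a i))); first by apply/moveBP; exists a.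
  by rewrite state_be_upd.
- apply: tame_ext (tame_forall (moveB k) IHp) => s; split=> [h a|h v /moveBP[a ->]].
    rewrite -state_be_upd; apply: (h (fun i => ((s i).1, upd (s i).2 k (a i)))).
    by apply/moveBP; exists a.
  by rewrite state_be_upd; exact: (h a).
Qed.

End FefermanVaught.

(** * Closure properties of generated sigma-algebras *)

Section SigmaGen.
Variables (X : Type) (G : (X -> Prop) -> Prop).

Lemma sigma_gen_countable_union (T : countType) (A : T -> X -> Prop) :
  sigma_gen G (fun _ => False) -> (forall t, sigma_gen G (A t)) ->
  sigma_gen G (fun x => exists t, A t x).
Proof.
move=> G0 GA.
apply: (@sg_ext _ _ (fun x => exists j, if unpickle j is Some t then A t x else False)).
  by apply: sg_union => j; case: unpickle.
move=> x; split=> [[j]|[t At]]; first by case: unpickle => // t; exists t.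
by exists (pickle t); rewrite pickleK.
Qed.

Lemma sigma_gen_or A B : sigma_gen G A -> sigma_gen G B ->
  sigma_gen G (fun x => A x \/ B x).
Proof.
move=> GA GB; apply: (@sg_ext _ _ (fun x => exists j, (if j is 0 then A else B) x)).
  by apply: sg_union => -[|j].
move=> x; split=> [[[|j]]|[Ax|Bx]]; [by left|by right|by exists 0|by exists 1].
Qed.

Lemma sigma_gen_and A B : sigma_gen G A -> sigma_gen G B ->
  sigma_gen G (fun x => A x /\ B x).
Proof.
move=> /sg_compl GA /sg_compl GB; apply: (sg_ext (sg_compl (sigma_gen_or GA GB))) => x.
by rewrite not_orE !not_notE.
Qed.

Hypothesis GT : sigma_gen G (fun _ => True).

Lemma sigma_gen_const (p : Prop) : sigma_gen G (fun _ => p).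
Proof.
case: (pselect p) => hp; first by apply: (sg_ext GT).
by apply: (sg_ext (sg_compl GT)) => x; split=> // /(_ Logic.I).
Qed.

(** Such a [P] is a finite Boolean combination of the sets [O j]; the induction splits on one of
    them at a time. *)
Lemma sigma_gen_determined (J : eqType) (O : J -> X -> Prop) (js : seq J) (P : X -> Prop) :
  (forall j, sigma_gen G (O j)) ->
  (forall x y, (forall j, j \in js -> O j x <-> O j y) -> P x -> P y) ->
  sigma_gen G P.
Proof.
move=> GO; elim: js P => [|j js IH] P hP.
  case: (pselect (exists x, P x)) => [[x Px]|nP].
    by apply: (sg_ext GT) => y; split=> // _; apply: hP Px.
  by apply: (sg_ext (sigma_gen_const False)) => y; split=> // Py; apply: nP; exists y.
(* [Q b] forgets the truth value of [O j]: it asks for a point of [P] with value [b] there and the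
   same values as [x] on the remaining sets. *)
pose Q b x := exists y, [/\ O j y <-> b = true, forall j', j' \in js -> O j' x <-> O j' y
  & P y].
have GQ b : sigma_gen G (Q b).
  apply: IH => x y xy [z [zb xz Pz]]; exists z; split=> // j' j'js.
  by rewrite -xz //; symmetry; apply: xy.
apply: (sg_ext (sigma_gen_or (sigma_gen_and (GO j) (GQ true))
  (sigma_gen_and (sg_compl (GO j)) (GQ false)))) => x; split.
- case=> -[Ox [y [yb xy Py]]]; apply: hP Py => j'; rewrite inE => /orP[/eqP->|/xy].
  + by split=> // _; apply/yb.
  + by tauto.
  + by split=> [/yb|/Ox].
  + by tauto.
- move=> Px; case: (pselect (O j x)) => Ox; [left|right]; split=> //.
    by exists x; split.
  by exists x; split.
Qed.

End SigmaGen.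

(** * The Cantor space as a Polish space, and smoothness from a countable separating family *)

Section CantorSpace.
Local Open Scope R_scope.

Definition agree n (x y : nat -> bool) := forall k, (k < n)%N -> x k = y k.

Definition half_pow (n : nat) : R := pow (/ 2) n.

Lemma half_pow_gt0 n : 0 < half_pow n.
Proof. by apply: pow_lt; lra. Qed.

Lemma half_pow_le n m : (n <= m)%N -> half_pow m <= half_pow n.
Proof.
elim: m => [|m IH]; first by rewrite leqn0 => /eqP->; apply: Rle_refl.
rewrite leq_eqVlt => /orP[/eqP->|/IH]; first exact: Rle_refl.
by have := half_pow_gt0 m; rewrite /half_pow /=; lra.
Qed.

Lemma half_pow_lt n m : (n < m)%N -> half_pow m < half_pow n.
Proof.
by move=> /half_pow_le; have := half_pow_gt0 n; rewrite /half_pow /=; lra.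
Qed.

Lemma half_pow_small eps : 0 < eps -> exists n, half_pow n < eps.
Proof.
move=> e0; have [|n /(_ n) hn] := @pow_lt_1_zero (/ 2) _ eps e0.
  by rewrite Rabs_pos_eq; lra.
exists n; have := half_pow_gt0 n; rewrite -[half_pow n]Rabs_pos_eq; last first.
  by apply/Rlt_le/half_pow_gt0.
by move=> _; apply: hn.
Qed.

Definition cantor_dist (x y : nat -> bool) : R :=
  if pselect (exists n, x n != y n) is left ex then half_pow (ex_minn ex) else 0.

Lemma cantor_dist_cases x y : cantor_dist x y = 0 \/ exists n, cantor_dist x y = half_pow n.
Proof. by rewrite /cantor_dist; case: pselect => ex; [right; eexists|left]. Qed.

Lemma cantor_dist_ge0 x y : 0 <= cantor_dist x y.
Proof.
case: (cantor_dist_cases x y) => [->|[n ->]]; first exact: Rle_refl.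
exact/Rlt_le/half_pow_gt0.
Qed.

(** This turns metric estimates into agreement of prefixes, the form used in all later arguments. *)
Lemma cantor_dist_le n x y : cantor_dist x y <= half_pow n <-> agree n x y.
Proof.
rewrite /cantor_dist; case: pselect => [ex|nex].
  case: ex_minnP => m ne_m min_m; split=> [le_mn k lt_kn|agr].
    apply/eqP; apply: contraT => /min_m le_mk.
    by have := half_pow_lt (leq_ltn_trans le_mk lt_kn); lra.
  by apply: half_pow_le; rewrite leqNgt; apply: contra ne_m => /agr/eqP.
split=> [_ k _|_]; last exact/Rlt_le/half_pow_gt0.
by apply/eqP; apply: contraT => ne_k; case: nex; exists k.
Qed.

Lemma cantor_dist_eq0 x y : cantor_dist x y = 0 <-> x = y.
Proof.
split=> [d0|->].
  apply/funext => k; suff /cantor_dist_le : cantor_dist x y <= half_pow k.+1 by apply.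
  by rewrite d0; apply/Rlt_le/half_pow_gt0.
by rewrite /cantor_dist; case: pselect => // ex; have [n] := ex; rewrite eqxx.
Qed.

Lemma cantor_dist_sym_le x y : cantor_dist x y <= cantor_dist y x.
Proof.
case: (cantor_dist_cases y x) => [/cantor_dist_eq0->|[n e]]; first exact: Rle_refl.
rewrite e; apply/cantor_dist_le => k lt_kn; symmetry.
by move: k lt_kn; apply/cantor_dist_le; rewrite e; apply: Rle_refl.
Qed.

Lemma cantor_dist_metric : is_metric cantor_dist.
Proof.
split=> [|||x y z].
- exact: cantor_dist_ge0.
- exact: cantor_dist_eq0.
- by move=> x y; apply: Rle_antisym; apply: cantor_dist_sym_le.
have := cantor_dist_ge0 x y; have := cantor_dist_ge0 y z.
case: (cantor_dist_cases x y) => [/[dup]/cantor_dist_eq0-> ->|[a ea]]; first by lra.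
case: (cantor_dist_cases y z) => [/[dup]/cantor_dist_eq0-> ->|[b eb]]; first by lra.
(* The stronger ultrametric inequality: prefixes of lengths [a] and [b] agree, hence so does the
   shorter one. *)
suff : cantor_dist x z <= half_pow (minn a b).
  by rewrite ea eb; case: leqP; lra.
apply/cantor_dist_le => k; rewrite leq_min => /andP[ka kb].
have /cantor_dist_le-> // : cantor_dist x y <= half_pow a by rewrite ea; apply: Rle_refl.
have /cantor_dist_le-> // : cantor_dist y z <= half_pow b by rewrite eb; apply: Rle_refl.
Qed.

Lemma cantor_complete : complete_metric cantor_dist.
Proof.
move=> u cu.
have /choice[N NP] n : exists N, forall m k, (N <= m)%N -> (N <= k)%N -> agree n (u m) (u k).
  have [N NP] := cu _ (half_pow_gt0 n); exists N => m k /leP le_m /leP le_k.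
  by apply/cantor_dist_le/Rlt_le/NP.
(* Diagonal limit: entry [n] is read at stage [N n.+1], from which the first n + 1 entries no longer
   change. *)
exists (fun n => u (N n.+1) n) => eps /half_pow_small[n lt_n].
exists (N n) => m /leP le_m; apply: Rle_lt_trans lt_n; apply/cantor_dist_le => k lt_kn.
rewrite (NP n m (maxn m (N k.+1))) // ?leq_max ?le_m //.
by apply: (NP k.+1) => //; rewrite leq_max leqnn orbT.
Qed.

Lemma cantor_separable : separable_metric cantor_dist.
Proof.
(* The dense countable set consists of the eventually false sequences, coded by finite lists. *)
pose S (y : nat -> bool) := exists l : seq bool, y = nth false l.
exists S; split.
  exists (fun y => if pselect (S y) is left e then pickle (sval (cid e)) else 0%N) => x y.
  case: pselect => // ex _; case: pselect => // ey _.
  case: (cid ex) => /= l1 -> {ex}; case: (cid ey) => /= l2 -> {ey}.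
  by move/(pcan_inj pickleK)->.
move=> y eps /half_pow_small[n lt_n]; exists (nth false (mkseq y n)).
split; first by eexists.
by apply: Rle_lt_trans lt_n; apply/cantor_dist_le => k lt_kn; rewrite nth_mkseq.
Qed.

End CantorSpace.

(** The reduction sends [x] to the sequence of its memberships in the [W t]. Preimages of cylinders
    are measurable, and open sets are countable unions of cylinders. *)
Lemma smooth_of_separating_family (X : Type) (G : (X -> Prop) -> Prop) (E : X -> X -> Prop)
    (T : countType) (W : T -> X -> Prop) :
  sigma_gen G (fun _ => True) -> (forall t, sigma_gen G (W t)) ->
  (forall x y, E x y <-> forall t, W t x <-> W t y) -> smooth (sigma_gen G) E.
Proof.
move=> GT GW EW; exists (nat -> bool), cantor_dist; split.
  by split; [exact: cantor_dist_metric|split; [exact: cantor_complete|exact: cantor_separable]].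
pose theta x j := if unpickle j is Some t then `[< W t x >] else false.
have Gcyl (l : seq bool) : sigma_gen G (fun x => agree (size l) (theta x) (nth false l)).
  apply: (@sigma_gen_determined _ _ GT _ (fun j x => theta x j) (iota 0 (size l))).
    move=> j; rewrite /theta; case: (unpickle j) => [t|]; last exact: sigma_gen_const.
    by apply: (sg_ext (GW t)) => x; split=> /asboolP.
  move=> x y xy lx k lt_k; rewrite -lx //.
  have [|xyk yxk] := xy k; first by rewrite mem_iota.
  by apply/idP/idP.
exists theta; split=> [B|x y].
  elim=> {B} [B oB|B _|B _|B C _ IH BC].
  (* The preimage of the cylinder of [l] if that cylinder lies inside [B], and the empty set
     otherwise. *)
  - pose A (l : seq bool) x := (forall z, agree (size l) z (nth false l) -> B z) /\
      agree (size l) (theta x) (nth false l).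
    apply: (@sg_ext _ _ (fun x => exists l, A l x)).
      apply: sigma_gen_countable_union => [|l]; first exact: sigma_gen_const.
      by apply: sigma_gen_and => //; apply: sigma_gen_const.
    move=> x; split=> [[l [lB /lB]]//|/oB[eps [/half_pow_small[n lt_n] epsB]]].
    have agr : agree (size (mkseq (theta x) n)) (theta x) (nth false (mkseq (theta x) n)).
      by rewrite size_mkseq => k lt_k; rewrite nth_mkseq.
    exists (mkseq (theta x) n); split=> // z zl; apply: epsB; apply: Rle_lt_trans lt_n.
    apply/cantor_dist_le; rewrite size_mkseq in agr zl => k lt_k.
    by rewrite zl // agr.
  - exact: sg_compl.
  - exact: sg_union.
  - by apply: (sg_ext IH) => x; apply: BC.
rewrite EW; split=> [xy|xy t].
  by apply/funext => j; rewrite /theta; case: unpickle => // t; apply: asbool_equiv_eq.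
have /(congr1 (fun f => f (pickle t))) := xy.
by rewrite /theta pickleK => e; split=> /asboolP; [rewrite e|rewrite -e] => /asboolP.
Qed.

(** * Saturations of basic open sets separate the classes *)

Section Saturations.
Variables (X T : Type) (U : T -> X -> Prop) (E : X -> X -> Prop).
Hypothesis U_cover : forall z, exists t, U t z.
Hypothesis U_inter : forall z t1 t2, U t1 z -> U t2 z ->
  exists2 t, U t z & forall z', U t z' -> U t1 z' /\ U t2 z'.

Definition basic_open (O : X -> Prop) :=
  forall z, O z -> exists2 t, U t z & forall z', U t z' -> O z'.

(** Only membership persists near [z]; non-membership may fail at nearby points, which is why a
    maximality argument follows. *)
Lemma basic_nbhd (J : eqType) (O : J -> X -> Prop) (js : seq J) z :
  (forall j, basic_open (O j)) ->
  exists2 t, U t z & forall z', U t z' -> forall j, j \in js -> O j z -> O j z'.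
Proof.
move=> oO; elim: js => [|j js [t Ut tO]].
  by have [t Ut] := U_cover z; exists t.
case: (pselect (O j z)) => Oj; last first.
  by exists t => // z' Uz' j'; rewrite inE => /orP[/eqP-> //|/(tO _ Uz')].
have [t' Ut' t'O] := oO _ _ Oj; have [t0 Ut0 t0P] := U_inter Ut Ut'.
exists t0 => // z' /t0P[Uz' /t'O O'] j'; rewrite inE => /orP[/eqP-> //|].
exact: tO.
Qed.

Hypothesis hE : Equivalence E.
Hypothesis E_class : forall x, exists (J : finType) (O : J -> X -> Prop),
  (forall j, basic_open (O j)) /\
  forall z z', (forall j, O j z <-> O j z') -> E x z -> E x z'.

(* In the common closure of the two classes pick a point [z] lying in as many as
   possible of the finitely many open sets determining both classes. Near [z] and
   inside the closure membership in these sets is constant, and both classes come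
   arbitrarily close to [z], so both contain [z]. *)
Lemma E_of_same_saturations x y :
  (forall t, (exists z, E x z /\ U t z) <-> (exists z, E y z /\ U t z)) -> E x y.
Proof.
move=> xy.
have [J1 [O1 [oO1 O1P]]] := E_class x; have [J2 [O2 [oO2 O2P]]] := E_class y.
pose O (j : J1 + J2) := match j with inl j1 => O1 j1 | inr j2 => O2 j2 end.
have oO j : basic_open (O j) by case: j.
pose D z := [set j | `[< O j z >]].
pose cl z := forall t, U t z -> exists z', E x z' /\ U t z'.
have clx z : E x z -> cl z by move=> Exz t Utz; exists z.
have cly z : E y z -> cl z by move=> Eyz t Utz; apply/xy; exists z.
pose score n := `[< exists2 z, cl z & #|D z| = n >].
have exs : exists n, score n.
  by exists #|D x|; apply/asboolP; exists x => //; apply: clx; reflexivity.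
have bnd n : score n -> n <= #|{: J1 + J2}| by case/asboolP=> z _ <-; apply: max_card.
case: (ex_maxnP exs bnd) => n /asboolP[z clz Dz] maxn.
have [t Utz tO] := basic_nbhd (enum {: J1 + J2}) z oO.
have const z' : U t z' -> cl z' -> forall j, O j z' <-> O j z.
  move=> Utz' clz' j.
  have sD : D z \subset D z'.
    by apply/subsetP => j'; rewrite !inE => /asboolP/(tO _ Utz' _ (mem_enum _ _))/asboolP.
  have /eqP eD : D z == D z'.
    by rewrite eqEcard sD Dz; apply: maxn; apply/asboolP; exists z'.
  have := congr1 (fun A : {set J1 + J2} => j \in A) eD.
  by rewrite !inE => e; split=> /asboolP Oj; apply/asboolP; rewrite ?e // -e.
have [z1 [Exz1 Uz1]] := clz t Utz.
have /xy[z2 [Eyz2 Uz2]] : exists z, E x z /\ U t z by exists z1.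
transitivity z.
  by apply: (O1P _ _ _ Exz1) => j; apply: (const z1 Uz1 (clx _ Exz1) (inl j)).
symmetry; apply: (O2P _ _ _ Eyz2) => j; exact: (const z2 Uz2 (cly _ Eyz2) (inr j)).
Qed.

End Saturations.

Lemma mem_In (T : eqType) (x : T) (l : seq T) : x \in l -> In x l.
Proof. by elim: l => //= y l IH; rewrite inE => /orP[/eqP->|/IH]; [left|right]. Qed.

(** * Tame equivalence relations on the product space are smooth *)

Section ProductSpace.
Variables (L : language) (I : eqType) (M : I -> structure L) (n : nat).
Let X : Type := Fin.t n -> prodM M.
Let row (i : I) : Type := Fin.t n -> M i.

(** The bound is witnessed by finitely many indices, and fixing all n coordinates there preserves
    their colours. *)
Lemma prod_open_atleast (K : finType) (c : forall i, row i -> K) m k :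
  prod_open (fun x : X => atleast m (fun i => c i (fun j => x j i) = k)).
Proof.
move=> x [l [Ul sl] lc]; have [js jsP] := FinFun.Fin_Finite n.
exists (list_prod js l) => y yx; exists l => // i li; rewrite -(lc i li).
congr c; apply/funext => j; apply: (yx (j, i)).
by apply/in_prod; [exact: jsP|exact: mem_In].
Qed.

Lemma prod_borelT : prod_borel (fun _ : X => True).
Proof. by apply: sg_base => x _; exists nil. Qed.

(** The truncated counts amount to membership in finitely many open sets, one for each colour and
    each threshold from 0 to [N]. *)
Lemma tame_borel (P : (forall i, row i) -> Prop) :
  tame P -> prod_borel (fun x : X => P (fun i j => x j i)).
Proof.
move=> [K [c [N [N0 cP]]]].
pose O (a : K * 'I_N.+1) (x : X) := atleast a.2 (fun i => c i (fun j => x j i) = a.1).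
apply: (@sigma_gen_determined _ _ prod_borelT _ O (enum {: K * 'I_N.+1})).
  by move=> a; apply: sg_base; apply: prod_open_atleast.
move=> x y xy; apply: cP => k m le_m.
by apply: (xy (k, Ordinal (le_m : m < N.+1))); rewrite mem_enum.
Qed.

Variables (E : X -> X -> Prop) (hE : Equivalence E).
Hypothesis E_tame : tame (fun s : forall i, (row i * row i)%type =>
  E (fun j i => (s i).1 j) (fun j i => (s i).2 j)).
Variables (g : I -> nat) (g_inj : injective g).
Variables (gM : forall i, M i -> nat) (gM_inj : forall i, injective (@gM i)).

(* A finite list of triples (j, g i, v) prescribes the code v of the coordinate [y j i]. *)
Definition cyl (l : seq (nat * nat * nat)) (y : X) :=
  forall j i v, (fin_nat j, g i, v) \in l -> gM (y j i) = v.

Lemma prod_open_basic O : prod_open O -> basic_open cyl O.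
Proof.
move=> oO z /oO[F FO].
exists [seq (fin_nat p.1, g p.2, gM (z p.1 p.2)) | p <- F].
  move=> j i v; elim: F {FO} => //= -[j' i'] F IH; rewrite inE => /orP[|/IH//].
  move=> /eqP[/Fin.to_nat_inj-> /g_inj ei ->].
  by rewrite ei.
move=> z' z'l; apply: FO => -[j i] /= Fji; apply: gM_inj; apply: z'l.
elim: F Fji => //= p F IH [->|/IH]; first exact: mem_head.
by rewrite inE orbC => ->.
Qed.

Lemma cyl_cover z : exists l, cyl l z.
Proof. by exists [::]. Qed.

Lemma cyl_inter z l1 l2 : cyl l1 z -> cyl l2 z ->
  exists2 l, cyl l z & forall z', cyl l z' -> cyl l1 z' /\ cyl l2 z'.
Proof.
move=> z1 z2; exists (l1 ++ l2) => [j i v|z' z'l].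
  by rewrite mem_cat => /orP[/z1|/z2].
by split=> j i v l_in; apply: z'l; rewrite mem_cat l_in ?orbT.
Qed.

(** A cylinder constrains each index separately, so it can be built into the move [R]; the
    saturation is then tame by [tame_ex]. *)
Lemma saturation_borel l : prod_borel (fun x : X => exists y, E x y /\ cyl l y).
Proof.
pose R i (u v : row i * row i) :=
  v.1 = u.1 /\ forall j a, (fin_nat j, g i, a) \in l -> gM (v.2 j) = a.
(* The diagonal turns [x] into a starting pair; [R] keeps its first component and replaces the
   second by a point of the cylinder. *)
apply: (sg_ext (tame_borel (tame_pullback (fun i (u : row i) => (u, u))
  (tame_ex R E_tame)))) => x; split=> [[v Rv Ev]|[y [Exy yl]]].
  exists (fun j i => (v i).2 j); split; last by move=> j i a; case: (Rv i) => _; apply.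
  suff -> : x = (fun j i => (v i).1 j) by [].
  apply/funext => j; apply/functional_extensionality_dep => i.
  by case: (Rv i) => ->.
exists (fun i => (fun j => x j i, fun j => y j i)) => // i.
by split=> // j a; apply: yl.
Qed.

(** Freezing [x] inside the colouring leaves counting conditions on [z] alone, and these are
    open. *)
Lemma class_open_determined x : exists (J : finType) (O : J -> X -> Prop),
  (forall j, basic_open cyl (O j)) /\
  forall z z', (forall j, O j z <-> O j z') -> E x z -> E x z'.
Proof.
have [K [c [N [N0 cP]]]] := E_tame.
exists (K * 'I_N.+1)%type, (fun (a : K * 'I_N.+1) (z : X) =>
  atleast a.2 (fun i => c i (fun j => x j i, fun j => z j i) = a.1)); split.
  move=> a; apply: prod_open_basic.
  exact: (@prod_open_atleast K (fun i u => c i (fun j => x j i, u)) a.2 a.1).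
move=> z z' zz' Exz.
apply: (cP (fun i => (fun j => x j i, fun j => z j i))
           (fun i => (fun j => x j i, fun j => z' j i))) Exz => k m le_m.
exact: (zz' (k, Ordinal (le_m : m < N.+1))).
Qed.

Lemma tame_smooth : smooth (@prod_borel L I M n) E.
Proof.
apply: (smooth_of_separating_family prod_borelT saturation_borel) => x y.
split=> [Exy l|]; last first.
  exact: (E_of_same_saturations cyl_cover cyl_inter hE class_open_determined).
by split=> -[z [Ez lz]]; exists z; split=> //; [transitivity x; first symmetry|transitivity y].
Qed.

End ProductSpace.

(** * From definable relations to tame ones, and the conclusion *)

Lemma fin_nat_decode n : exists dec : nat -> option (Fin.t n + Fin.t n),
  forall k, dec (fin_nat k) = Some (inl k) /\ dec (n + fin_nat k) = Some (inr k).
Proof.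
have lt_n (k : Fin.t n) : fin_nat k < n by apply/ltP; exact: (svalP (Fin.to_nat k)).
exists (fun m =>
  if pselect (exists k : Fin.t n, fin_nat k = m) is left e then Some (inl (sval (cid e)))
  else if pselect (exists k : Fin.t n, n + fin_nat k = m) is left e
  then Some (inr (sval (cid e))) else None) => k; split.
  case: pselect => [e|[]]; last by exists k.
  by case: cid => /= k' /Fin.to_nat_inj->.
case: pselect => [[k' e]|_]; first by have := lt_n k'; rewrite e; lia.
case: pselect => [e|[]]; last by exists k.
by case: cid => /= k' /addnI/Fin.to_nat_inj->.
Qed.

Lemma tame_definable (L : language) (I : eqType) (M : I -> structure L) (n : nat)
    (E : (Fin.t n -> prodM M) -> (Fin.t n -> prodM M) -> Prop) (a0 : prodM M) :
  fv_definable_rel E ->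
  tame (fun s : forall i, ((Fin.t n -> M i) * (Fin.t n -> M i))%type =>
    E (fun j i => (s i).1 j) (fun j i => (s i).2 j)).
Proof.
move=> [psi psiP]; have [dec decP] := fin_nat_decode n.
(* Product variables outside the 2n relevant ones are set to [a0] and set variables to the empty
   set; definability makes the truth value independent of these defaults. *)
pose h i (u : (Fin.t n -> M i) * (Fin.t n -> M i)) : fv_state M i :=
  (fun k => match dec k with
            | Some (inl j) => u.1 j | Some (inr j) => u.2 j | None => a0 i end,
   fun _ => False).
apply: tame_ext (tame_pullback h (tame_fvsat M psi)) => s.
symmetry; apply: psiP => k; rewrite /state_pe /h /=.
by have [d1 d2] := decP k; split; apply/functional_extensionality_dep => i;
  rewrite ?d1 ?[dec _]d2.
Qed.

Theorem mainTheorem20 (L : language) (I : Type) (M : I -> structure L)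
  (hI : countable_type I) (hM : forall i : I, countable_type (carrier (M i)))
  (n : nat) (E : (Fin.t n -> prodM M) -> (Fin.t n -> prodM M) -> Prop)
  (hE : Equivalence E) (hdef : @fv_definable_rel L I M n E) :
  smooth (@prod_borel L I M n) E.
Proof.
case: (pselect (exists a : prodM M, True)) => [[a0 _]|noM].
  have [g g_inj] := hI.
  pose gM i := sval (cid (hM i)).
  have gM_inj i : injective (gM i) := svalP (cid (hM i)).
  exact: (@tame_smooth L {classic I} M n E hE
    (@tame_definable L {classic I} M n E a0 hdef) g g_inj gM gM_inj).
(* With an empty product the space of n-tuples has at most one point, so a single trivial set
   separates the classes. *)
apply: (@smooth_of_separating_family _ _ E unit (fun _ _ => True)) => [||x y].
- by apply: sg_base => x _; exists nil.
- by move=> _; apply: sg_base => x _; exists nil.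
- split=> // _; suff -> : x = y by reflexivity.
  by apply/funext => k; case: noM; exists (x k).
Qed.
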